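(* Let $\mathfrak g$ be a finite-dimensional Lie algebra over $\mathbb C$ and let $N:\mathfrak g\to\mathfrak g$ be a diagonalizable Nijenhuis operator with spectrum $\operatorname{Sp}N=\{\lambda_1,\ldots,\lambda_n\}$ (the $\lambda_i$ pairwise distinct). Assume that the complement in $\mathfrak g^*$ of the set $$\bigcup_{\lambda\in\mathbb C\setminus \operatorname{Sp}N}{}^t(N-\lambda\,\mathrm{Id})(\operatorname{Sing}\mathfrak g^* )$$ contains an open dense subset of $\mathfrak g^*$, where $\operatorname{Sing}\mathfrak g^*$ is the union of all coadjoint orbits of nonmaximal dimension and ${}^tB:\mathfrak g^*\to\mathfrak g^*$ denotes the transpose of a linear operator $B:\mathfrak g\to\mathfrak g$. Put $\check{\mathfrak g}_i:=\operatorname{im}(N-\lambda_i\mathrm{Id})$, $i=1,\ldots,n$ (these are Lie subalgebras of $\mathfrak g$). If for every $i$, $1\le i\le n$, $$\operatorname{ind}\check{\mathfrak g}_i+\operatorname{codim}\check{\mathfrak g}_i=\operatorname{ind}\mathfrak g$$ (where $\operatorname{codim}\check{\mathfrak g}_i=\dim\mathfrak g-\dim\check{\mathfrak g}_i$), then the Poisson pencil $\{\theta_N^s\}_{s\in\mathbb C^2}$ on $\mathfrak g^*$ is Kronecker.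
   Context: A linear operator $N:\mathfrak g\to\mathfrak g$ on a Lie algebra $(\mathfrak g,[,])$ is called Nijenhuis if $[Nx,Ny]-N([Nx,y]+[x,Ny])+N^2[x,y]=0$ for all $x,y\in\mathfrak g$. For a Nijenhuis operator $N$, the operation $[x,y]_N:=[Nx,y]+[x,Ny]-N[x,y]$ is a Lie bracket on $\mathfrak g$, and every linear combination $s_1[,]+s_2[,]_N$ is a Lie bracket. Let $\theta_1,\theta_2$ be the (holomorphic) Lie–Poisson bivectors on $\mathfrak g^*$ corresponding to $[,]$ and $[,]_N$ respectively. The associated Poisson pencil is the family $\theta_N^s:=s_1\theta_1+s_2\theta_2$, $s=(s_1,s_2)\in\mathbb C^2$. A Poisson pencil $\{\theta^s\}$ on a connected complex manifold $M$ is Kronecker at $x\in M$ if $\operatorname{rank}_{\mathbb C}\theta^s_x$ is constant with respect to $s\in\mathbb C^2\setminus\{0\}$; the pencil is called Kronecker (micro-Kronecker) if it is Kronecker at every point of some open dense subset of $M$. The index $\operatorname{ind}\mathfrak a$ of a Lie algebra $\mathfrak a$ is the codimension in $\mathfrak a^*$ of a generic coadjoint orbit. *)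

(* Defs.v *)
From HB Require Import structures.
From mathcomp Require Import all_boot all_order all_algebra.
From mathcomp Require Import all_classical all_reals all_analysis.
From mathcomp Require Import complex ring.

Set Implicit Arguments.
Unset Strict Implicit.
Unset Printing Implicit Defensive.

Import Order.TTheory GRing.Theory Num.Theory.
Import numFieldNormedType.Exports passmx.

Local Open Scope classical_set_scope.
Local Open Scope ring_scope.

(* Everything is developed over a numFieldType K, whose norm induces the
   topology used on K; the theorem instantiates K with R[i], R : realType. *)

Section Topology.
Variables (K : numFieldType) (V : vectType K).

Definition coords (v : V) : 'rV[K]_(\dim {:V}) := rVof (vbasis {:V}) v.

(* The canonical topology of a finite-dimensional space is transported from
   K^n by the coordinates in a basis; linear automorphisms of K^n being
   homeomorphisms, the choice of the basis is immaterial. *)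
Definition open_dense (U : set V) : Prop :=
  open [set r | U (vecof (vbasis {:V}) r)] /\
  dense [set r | U (vecof (vbasis {:V}) r)].

Definition vcvg (u : nat -> V) (v : V) : Prop :=
  (fun k => coords (u k)) @ \oo --> coords v.

(* Pointwise convergence of the exponential series, which in finite dimension
   is the same as convergence in End(V). *)
Definition is_exp (D E : 'End(V)) : Prop :=
  forall v : V,
    vcvg (fun n => \sum_(k < n) ((k`!)%:R)^-1 *: iter k (fun w => D w) v) (E v).

End Topology.

Definition dual_space (K : fieldType) (V : vectType K) : vectType K :=
  'Hom(V, K^o).

Definition transpose (K : fieldType) (V : vectType K) (B : 'End(V))
  (xi : dual_space V) : dual_space V := (xi \o B)%VF.

Section Lie.
Variables (K : numFieldType) (g : vectType K) (br : g -> g -> g).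

Record is_lie_bracket : Prop := IsLieBracket {
  lie_linear_l : forall y, linear (fun x => br x y);
  lie_linear_r : forall x, linear (br x);
  lie_alternating : forall x, br x x = 0;
  lie_jacobi : forall x y z,
    br x (br y z) + br y (br z x) + br z (br x y) = 0
}.

Definition ad (x : g) : 'End(g) := linfun (br x).

(* The coadjoint orbit of xi under the connected Lie group with Lie algebra g.
   The coadjoint action of exp(-x) is xi |-> xi \o exp(ad x), and a connected
   Lie group is generated by the image of its exponential map. *)
Inductive coadjoint_orbit (xi : dual_space g) : dual_space g -> Prop :=
| orbit_refl : coadjoint_orbit xi xi
| orbit_step : forall (eta : dual_space g) (x : g) (A : 'End(g)),
    coadjoint_orbit xi eta -> is_exp (ad x) A ->
    coadjoint_orbit xi (transpose A eta).

Definition coad (x : g) (xi : dual_space g) : dual_space g :=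
  - transpose (ad x) xi.

(* The tangent space at xi of its coadjoint orbit: the image of the
   differential x |-> coad x xi, at the neutral element, of the orbit map. *)
Definition orbit_tangent (xi : dual_space g) : {vspace dual_space g} :=
  limg (linfun (fun x : g => coad x xi)).

Definition orbit_dim (xi : dual_space g) : nat := \dim (orbit_tangent xi).

Definition sing : set (dual_space g) :=
  \bigcup_(xi in [set xi | exists zeta, (orbit_dim xi < orbit_dim zeta)%N])
    [set eta | coadjoint_orbit xi eta].

(* r is the codimension of the orbits through the points of an open dense set;
   such an r is unique since two open dense sets meet. *)
Definition is_index (r : nat) : Prop :=
  exists U : set (dual_space g), open_dense U /\
    forall xi, U xi -> (\dim {:dual_space g} - orbit_dim xi)%N = r.

Definition lie_index : nat := xget 0%N [set r | is_index r].

(* The bracket induced on a Lie subalgebra h; vsproj h is the inverse of the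
   inclusion vsval on h, which contains the brackets of its elements. *)
Definition sub_bracket (h : {vspace g}) (x y : subvs_of h) : subvs_of h :=
  vsproj h (br (vsval x) (vsval y)).

Definition nijenhuis (N : 'End(g)) : Prop :=
  forall x y, br (N x) (N y) - N (br (N x) y + br x (N y)) + N (N (br x y)) = 0.

Definition nijenhuis_bracket (N : 'End(g)) (x y : g) : g :=
  br (N x) y + br x (N y) - N (br x y).

End Lie.

Lemma nijenhuis_im_subalgebra (K : numFieldType) (g : vectType K)
  (br : g -> g -> g) (N : 'End(g)) (a : K) :
  is_lie_bracket br -> nijenhuis br N ->
  forall x y, x \in limg (N - a *: \1%VF) -> y \in limg (N - a *: \1%VF) ->
    br x y \in limg (N - a *: \1%VF).
Proof.
move=> [linl linr _ _] Nij _ _ /memv_imgP[x _ ->] /memv_imgP[y _ ->].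
have brDl u v w : br (u + v) w = br u w + br v w.
  by have := linl w 1 u v; rewrite /= !scale1r.
have brDr u v w : br w (u + v) = br w u + br w v.
  by have := linr w 1 u v; rewrite /= !scale1r.
have br0l w : br 0 w = 0 by apply: (addrI (br 0 w)); rewrite -brDl !addr0.
have br0r w : br w 0 = 0 by apply: (addrI (br w 0)); rewrite -brDr !addr0.
have brZl c u w : br (c *: u) w = c *: br u w.
  by have := linl w c u 0; rewrite /= addr0 br0l addr0.
have brZr c u w : br w (c *: u) = c *: br w u.
  by have := linr w c u 0; rewrite /= addr0 br0r addr0.
pose M := (N - a *: \1)%VF.
have ME z : M z = N z - a *: z.
  by rewrite add_lfunE opp_lfunE scale_lfunE id_lfunE.
suff -> : br (M x) (M y) = M (br (M x) y + br x (M y) - M (br x y)).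
  by rewrite memv_img // memvf.
have brNl u w : br (- u) w = - br u w by rewrite -scaleN1r brZl scaleN1r.
have brNr u w : br w (- u) = - br w u by rewrite -scaleN1r brZr scaleN1r.
have NN : br (N x) (N y) = N (br (N x) y) + N (br x (N y)) - N (N (br x y)).
  by apply/eqP; rewrite -subr_eq0 opprB addrA addrAC -linearD /= Nij.
rewrite !ME !(brDl, brDr, brNl, brNr, brZl, brZr) NN.
have ND u v : N (u + v) = N u + N v by rewrite linearD.
have NB u : N (- u) = - N u by rewrite linearN.
have NZ c u : N (c *: u) = c *: N u by rewrite linearZ.
rewrite !(ND, NB, NZ).
pose c := rVof (vbasis {:g}).
have cD : {morph c : u v / u + v} by move=> u v; rewrite /c linearD.
have cN : {morph c : u / - u} by move=> u; rewrite /c linearN.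
have cZ k u : c (k *: u) = k *: c u by rewrite /c linearZ.
apply: (can_inj (rVofK (vbasisP {:g}))).
rewrite -/c !(cD, cN, cZ); apply/rowP => i; rewrite !mxE; ring.
Qed.

Section Operators.
Variables (K : fieldType) (V : vectType K).

Definition spectrum (N : 'End(V)) : set K := [set a | leigenvalue N a].

Definition diagonalizable_op (N : 'End(V)) : Prop :=
  exists2 e : seq V, basis_of fullv e &
    forall v, v \in e -> exists a : K, N v = a *: v.

End Operators.

Section Poisson.
Variables (K : numFieldType) (V : vectType K).

(* Bivector fields on the dual of V. The cotangent space at each point is
   the bidual of V, identified with V, so that a bivector at a point is a
   skew-symmetric bilinear form on V. *)
Definition bivector_field := dual_space V -> V -> V -> K.

(* The rank of a bivector b, viewed as the map T^* -> T, x |-> b x. *)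
Definition bivector_rank (b : V -> V -> K) : nat :=
  \dim (limg (linfun (fun x : V => linfun (b x : V -> K^o) : dual_space V))).

(* {f, h}(xi) = xi [df_xi, dh_xi] *)
Definition lie_poisson (br : V -> V -> V) : bivector_field :=
  fun xi x y => xi (br x y).

Definition pencil (theta1 theta2 : bivector_field) (s : K * K) :
  bivector_field :=
  fun xi x y => s.1 * theta1 xi x y + s.2 * theta2 xi x y.

Definition kronecker_at (theta : K * K -> bivector_field)
  (xi : dual_space V) : Prop :=
  forall s t : K * K, s <> (0, 0) -> t <> (0, 0) ->
    bivector_rank (theta s xi) = bivector_rank (theta t xi).

Definition kronecker (theta : K * K -> bivector_field) : Prop :=
  exists U : set (dual_space V), open_dense U /\
    forall xi, U xi -> kronecker_at theta xi.

End Poisson.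

(* Main.v *)
Require Import Defs.
From HB Require Import structures.
From mathcomp Require Import all_boot all_order all_algebra.
From mathcomp Require Import all_classical all_reals all_analysis.
From mathcomp Require Import complex ring zify.

Set Implicit Arguments.
Unset Strict Implicit.
Unset Printing Implicit Defensive.

Import Order.TTheory GRing.Theory Num.Theory.
Import numFieldNormedType.Exports passmx.

Local Open Scope classical_set_scope.
Local Open Scope ring_scope.
Local Open Scope complex_scope.

(** Fix xi in the dual of g and let r(s, xi) be the rank of the form theta^s at
    xi. Let D be the maximum of r((1, 0), -), so that ind g = dim g - D
    ([lie_indexE]). Up to a nonzero factor, every theta^s is either theta_1 or
    the Lie-Poisson bivector of the bracket [,]_M = [,]_N - l [,] of the
    Nijenhuis operator M = N - l Id, and the Nijenhuis identity says that M is a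
    homomorphism from [,]_M to [,] ([nijenhuis_shift]).

    If l is not an eigenvalue, then M is bijective, hence r((-l, 1), xi) is the
    dimension of the coadjoint orbit through the preimage of xi under the
    transpose of M ([rank_shift_regular]). This preimage is not singular for xi
    in the given open dense set U, and so r((-l, 1), xi) = D.

    If l is an eigenvalue, two inequalities are needed. Upper bound: a minor of
    theta^(-l, 1) at xi is a polynomial in l, so a minor of size D + 1 that
    did not vanish at the eigenvalue would not vanish at some regular value
    either ([rank_specialization], [exists_nonroot]). Lower bound: linear forms
    pulled back along M from im M have the rank that the Lie-Poisson structure
    of im M gives them ([rank_shift_singular]); its maximum is
    dim (im M) - ind (im M), which is D by the hypothesis on the indices. The
    locus where the rank of a Lie-Poisson bivector is at least D is the
    nonvanishing locus of minors, so it is open, and dense as soon as it is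
    nonempty ([rank_geq_open_dense]). Intersecting U with finitely many such
    loci gives an open dense set of points at which r(s, xi) = D for all
    nonzero s. *)

(** * Nonvanishing of determinants *)

Section Nonvanishing.
Variable K : numFieldType.

Lemma exists_nonroot (p : {poly K}) (u : nat -> K) :
  p != 0 -> injective u -> exists k, p.[u k] != 0.
Proof.
move=> p0 ui; pose rs := [seq u k | k <- iota 0 (size p)].
have /negP : ~ all (root p) rs.
  move=> all_root.
  have := max_poly_roots p0 all_root.
  by rewrite map_inj_uniq // iota_uniq size_map size_iota ltnn => /(_ isT).
by rewrite -has_predC => /hasP[_ /mapP[k _ ->] /= pk]; exists k.
Qed.

(** It serves both for moving along a line in the dual space (density) and for
    moving the parameter of the pencil (semicontinuity of the rank). *)
Lemma det_line_poly k (A B : 'M[K]_k) :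
  exists p : {poly K}, forall t, p.[t] = \det (A + t *: B).
Proof.
exists (\det (map_mx polyC A + 'X *: map_mx polyC B)) => t.
rewrite -horner_evalE -det_map_mx; congr (\det _).
apply/matrixP => i j; rewrite !mxE /horner_eval.
by rewrite /= /horner_eval !hornerE.
Qed.

Lemma det_continuous k : continuous (fun A : 'M[K]_k => \det A).
Proof.
move=> A; rewrite /determinant.
apply: (cvg_big add_continuous (F := nbhs A)) => s _.
apply: cvgM; first exact: cvg_cst.
apply: (cvg_big mul_continuous (F := nbhs A)) => i _.
exact: coord_continuous.
Qed.

Lemma linear_mx_continuous m k l (L : {linear 'rV[K]_m -> 'M[K]_(k, l)}) :
  continuous L.
Proof.
have LE r : L r = \sum_i r 0 i *: L (delta_mx 0 i).
  rewrite {1}(row_sum_delta r) linear_sum; apply: eq_bigr => i _.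
  by rewrite linearZ.
move=> r.
rewrite (_ : L = (fun r => \sum_i r 0 i *: L (delta_mx 0 i)) :> (_ -> _));
  last exact/funext.
apply: (cvg_big add_continuous (F := nbhs r)) => i _.
apply: cvgZr_tmp; exact: coord_continuous.
Qed.

Lemma det_neq0_open m k (L : {linear 'rV[K]_m -> 'M[K]_k}) :
  open [set r | \det (L r) != 0].
Proof.
rewrite (_ : mkset _ = (fun r => \det (L r)) @^-1` [set x | x != 0]) //.
apply: open_comp.
  move=> r _; apply: continuous_comp; first exact: linear_mx_continuous.
  exact: det_continuous.
rewrite openE => x /= x0; apply/nbhs_ballP.
exists `|x|; first by rewrite /= normr_gt0.
move=> y; rewrite /ball /= => lt; apply: contraTneq lt => ->.
by rewrite subr0 ltxx.
Qed.

(** On the line from any point r to r0 the determinant is a nonzero polynomial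
    in the parameter t, so it has only finitely many zeros near t = 0. *)
Lemma det_neq0_dense m k (L : {linear 'rV[K]_m -> 'M[K]_k}) r0 :
  \det (L r0) != 0 -> dense [set r | \det (L r) != 0].
Proof.
move=> L0 O [r Or] Oo.
pose d := r0 - r.
have [p pE] := det_line_poly (L r) (L d).
have p0 : p != 0.
  apply: contraNneq L0 => p0.
  by rewrite -(subrKC r r0) -/d linearD -[L d]scale1r -pE p0 horner0.
have cd : (fun t : K => r + t *: d) @ (0 : K) --> r + (0:K) *: d.
  apply: (@cvgD _ _ _ (nbhs (0 : K)) _ (cst r) (fun t => t *: d)).
    exact: cvg_cst.
  by apply: cvgZr_tmp; exact: cvg_id.
rewrite scale0r addr0 in cd.
have /nbhs_ballP[e /= e0 He] := cd _ (open_nbhs_nbhs (conj Oo Or)).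
(* Infinitely many distinct points of the ball of radius e. *)
have [k' Hk] : exists j, p.[e / j.+2%:R] != 0.
  apply: (exists_nonroot (u := fun j => e / j.+2%:R) p0) => i j.
  move=> /(mulfI (lt0r_neq0 e0)) /invr_inj.
  by move/eqP; rewrite eqr_nat !eqSS => /eqP.
exists (r + (e / k'.+2%:R) *: d); split.
  apply: He; rewrite /ball /= sub0r normrN ger0_norm; last first.
    by rewrite divr_ge0 ?ler0n ?(ltW e0).
  by rewrite ltr_pdivrMr ?ltr0n // ltr_pMr // ltr1n.
by rewrite /= linearD linearZ /= -pE.
Qed.

End Nonvanishing.

(** * Rank of a bilinear form *)

Lemma linfun_linearE (K : fieldType) (aT rT : vectType K) (f : aT -> rT) :
  linear f -> linfun f =1 f.
Proof.
move=> lin_f.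
pose fl : {linear aT -> rT} := HB.pack f (GRing.isLinear.Build _ _ _ _ f lin_f).
exact: (lfunE fl).
Qed.

Definition bilinear_map (K : fieldType) (V W : vectType K) (m : V -> V -> W) :
    Prop :=
  (forall y, linear (fun x => m x y)) /\ (forall x, linear (m x)).

Section BilinearRank.
Variables (K : numFieldType) (V : vectType K).

Lemma sum_dualE k (c : 'I_k -> K) (xi : 'I_k -> dual_space V) (v : V) :
  (\sum_i c i *: xi i) v = \sum_i c i * xi i v.
Proof.
transitivity (\sum_i (c i *: xi i : 'Hom(V, K^o)) v); first exact: sum_lfunE.
by apply: eq_bigr => i _; exact: scale_lfunE.
Qed.

(** Testing the rank by minors on arbitrary families of vectors, not on those of
    a basis, makes comparisons of ranks along maps immediate. *)
Lemma rank_geP (b : V -> V -> K) k : bilinear_map (W := K^o) b ->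
  (k <= bivector_rank b)%N <->
  exists f h : 'I_k -> V, \det (\matrix_(i, j) b (f i) (h j)) != 0.
Proof.
move=> [bl br]; rewrite /bivector_rank.
set phi := linfun _.
have phiE x y : phi x y = b x y.
  rewrite /phi linfun_linearE ?linfun_linearE // => a u v.
  apply/lfunP => z; rewrite add_lfunE scale_lfunE !linfun_linearE //.
  exact: bl.
split=> [lek|[f [h det_neq0]]].
  (* preimages of k independent linear forms, then a dual family of vectors *)
  pose w (i : 'I_k) := (vbasis (limg phi))`_i.
  have w_im i : exists x, w i == phi x.
    have : w i \in limg phi.
      by rewrite vbasis_mem // mem_nth // size_tuple (leq_trans (ltn_ord i)).
    by case/memv_imgP => x _ ->; exists x.
  pose f i := xchoose (w_im i).
  have fE i : phi (f i) = w i by apply/esym/eqP/(xchooseP (w_im i)).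
  pose A : 'M[K]_(k, \dim {:V}) := \matrix_(i, j) w i (vbasis {:V})`_j.
  have : row_free A.
    apply: inj_row_free => c cA.
    have cw_basis (l : 'I_(\dim {:V})) :
        (\sum_i c 0 i *: w i) (vbasis {:V})`_l = 0.
      transitivity ((c *m A) 0 l); last by rewrite cA mxE.
      rewrite mxE [LHS]sum_dualE.
      by apply: eq_bigr => i _; rewrite mxE.
    have cw0 : \sum_i c 0 i *: w i = 0.
      apply/lfunP => x; rewrite zero_lfunE (coord_vbasis (memvf x)) linear_sum.
      rewrite big1 // => l _; rewrite linearZ.
      by apply/eqP; rewrite scaler_eq0; apply/orP; right; apply/eqP/cw_basis.
    apply/rowP => i; rewrite mxE.
    have := congr1 (coord (vbasis (limg phi)) (widen_ord lek i)) cw0.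
    rewrite linear0 linear_sum (bigD1 i) //= big1 => [|j ji].
      rewrite addr0 linearZ /= (coord_free (widen_ord lek i) (widen_ord lek i)).
        by rewrite eqxx mulr1.
      exact: basis_free (vbasisP _).
    rewrite linearZ /= (coord_free (widen_ord lek j) (widen_ord lek i)).
      by rewrite -val_eqE /= val_eqE (negPf ji) mulr0.
    exact: basis_free (vbasisP _).
  case/row_freeP => B AB.
  exists f, (fun j => \sum_l B l j *: (vbasis {:V})`_l).
  rewrite (_ : \matrix_(_, _) _ = 1%:M) ?det1 ?oner_eq0 // -AB.
  apply/matrixP => i j; rewrite !mxE -phiE fE linear_sum.
  by apply: eq_bigr => l _; rewrite linearZ mxE mulrC.
pose X := [tuple phi (f i) | i < k].
have XE (i : 'I_k) : X`_i = phi (f i) by rewrite -tnth_nth tnth_mktuple.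
have /eqP <- : size X == k by rewrite size_tuple.
have /eqP <- : free X.
  apply/freeP => c cX i.
  have cA : \row_i c i *m (\matrix_(i, j) b (f i) (h j)) = 0.
    apply/rowP => j; rewrite !mxE.
    transitivity ((\sum_(i < k) c i *: X`_i) (h j)); last by rewrite cX lfunE.
    by rewrite [RHS]sum_dualE; apply: eq_bigr => l _; rewrite !mxE XE phiE.
  have /eqP/rowP/(_ i) : \row_i c i == 0; last by rewrite !mxE.
  have := congr1 (mulmxr (invmx (\matrix_(i, j) b (f i) (h j)))) cA.
  by rewrite /= mulmxK ?unitmxE ?unitfE // mul0mx => ->.
apply/dimvS/span_subvP => _ /mapP[i _ ->].
exact: memv_img (memvf _).
Qed.

End BilinearRank.

Section RankComparison.
Variables (K : numFieldType) (V : vectType K).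

(** The minor of b along (f, h) is the minor of b' along (p \o f, q \o h). *)
Lemma rank_le_pullback (W : vectType K) (b : V -> V -> K) (b' : W -> W -> K)
    (p q : V -> W) :
  bilinear_map (W := K^o) b -> bilinear_map (W := K^o) b' ->
  (forall x y, b x y = b' (p x) (q y)) ->
  (bivector_rank b <= bivector_rank b')%N.
Proof.
move=> bil bil' bE.
have /(rank_geP _ bil)[f [h det_neq0]] := leqnn (bivector_rank b).
apply/(rank_geP _ bil'); exists (p \o f), (q \o h).
by congr (\det _ != 0): det_neq0; apply/matrixP => i j; rewrite !mxE bE.
Qed.

Lemma rank_scale (b : V -> V -> K) c : bilinear_map (W := K^o) b -> c != 0 ->
  bivector_rank (fun x y => c * b x y) = bivector_rank b.
Proof.
move=> bil c0.
have scaleE a x y : b (a *: x) y = a * b x y.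
  case: bil => bl _.
  have b0y : b 0 y = 0.
    apply: (addrI (b 0 y)); have := bl y 1 0 0.
    by rewrite /= scaler0 !addr0 scale1r.
  by have := bl y a x 0; rewrite /= b0y !addr0.
have bilc : bilinear_map (W := K^o) (fun x y => c * b x y).
  case: bil => bl br; split=> [y a u v|x a u v].
    by rewrite (bl y a u v : b _ y = a * _ + _) mulrDr mulrCA.
  by rewrite (br x a u v : b x _ = a * _ + _) mulrDr mulrCA.
apply/eqP; rewrite eqn_leq; apply/andP; split.
  by apply: (rank_le_pullback (p := *:%R c) (q := id)) => // x y; rewrite scaleE.
apply: (rank_le_pullback (p := *:%R c^-1) (q := id)) => // x y.
by rewrite scaleE mulVKf.
Qed.

(** The polynomial p is a minor of size k that is nonzero at t0. *)
Lemma rank_specialization (b0 b1 : V -> V -> K) k t0 :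
  bilinear_map (W := K^o) b0 -> bilinear_map (W := K^o) b1 ->
  (k <= bivector_rank (fun x y => (b0 x y + t0 * b1 x y)%R))%N ->
  exists2 p : {poly K}, p != 0 & forall t, p.[t] != 0 ->
    (k <= bivector_rank (fun x y => (b0 x y + t * b1 x y)%R))%N.
Proof.
move=> [l0 r0] [l1 r1].
have bil t : bilinear_map (W := K^o) (fun x y => b0 x y + t * b1 x y).
  split=> [y a u v|x a u v].
    rewrite (l0 y a u v : b0 _ y = a * _ + _) (l1 y a u v : b1 _ y = a * _ + _).
    by rewrite mulrDr mulrCA addrACA -mulrDr.
  rewrite (r0 x a u v : b0 x _ = a * _ + _) (r1 x a u v : b1 x _ = a * _ + _).
  by rewrite mulrDr mulrCA addrACA -mulrDr.
move=> /(rank_geP _ (bil _))[f [h det_neq0]].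
have [p pE] := det_line_poly (\matrix_(i, j) b0 (f i) (h j))
  (\matrix_(i, j) b1 (f i) (h j)).
have detE t : \det (\matrix_(i, j) (b0 (f i) (h j) + t * b1 (f i) (h j))) = p.[t].
  by rewrite pE; congr (\det _); apply/matrixP => i j; rewrite !mxE.
exists p; first by apply: contraNneq det_neq0 => p0; rewrite detE p0 horner0.
by move=> t pt; apply/(rank_geP _ (bil _)); exists f, h; rewrite detE.
Qed.

End RankComparison.

(** * Open dense sets *)

Section OpenDense.
Variables (K : numFieldType) (V : vectType K).

Lemma open_denseT : open_dense [set: V].
Proof.
by split; [exact: openT | move=> O [r Or] _; exists r].
Qed.

Lemma open_denseI (A B : set V) :
  open_dense A -> open_dense B -> open_dense (A `&` B).
Proof. by move=> [oA dA] [oB dB]; split; [exact: openI | exact: denseI]. Qed.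

Lemma open_dense_forall (I : finType) (A : I -> set V) :
  (forall i, open_dense (A i)) -> open_dense [set v | forall i, A i v].
Proof.
move=> od; suff: open_dense [set v | forall i, i \in enum I -> A i v].
  congr open_dense; apply/seteqP.
  by split=> v /= Av i; [apply: Av; rewrite mem_enum | move=> _; exact: Av].
elim: (enum I) => [|j s ih].
  by rewrite (_ : mkset _ = setT); [exact: open_denseT | apply/seteqP; split].
rewrite (_ : mkset _ = A j `&` [set v | forall i, i \in s -> A i v]).
  exact: open_denseI.
apply/seteqP; split=> v /= => [Av|[Aj As] i].
  by split=> [|i is_]; apply: Av; rewrite inE ?eqxx ?is_ ?orbT.
by rewrite inE => /predU1P[->|/As].
Qed.

End OpenDense.

(** * Generic rank of a Lie-Poisson bivector, and the index *)

Section LiePoissonRank.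
Variables (K : numFieldType) (g : vectType K).
Implicit Types (m : g -> g -> g) (xi eta : dual_space g).

Lemma lie_poisson_bilinear m xi :
  bilinear_map m -> bilinear_map (W := K^o) (lie_poisson m xi).
Proof.
move=> [ml mr]; split=> [y a u v|x a u v]; rewrite /lie_poisson.
  by rewrite (ml y a u v) linearP.
by rewrite (mr x a u v) linearP.
Qed.

(** The minors of [lie_poisson m xi] are polynomials in xi. *)
Lemma rank_geq_open_dense m k xi0 : bilinear_map m ->
  (k <= bivector_rank (lie_poisson m xi0))%N ->
  open_dense [set xi | (k <= bivector_rank (lie_poisson m xi))%N].
Proof.
move=> bil; have lp_rank_geP xi := rank_geP k (lie_poisson_bilinear xi bil).
pose e := vbasis {:dual_space g}.
pose minor (f h : 'I_k -> g) (r : 'rV[K]_(\dim {:dual_space g})) : 'M[K]_k :=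
  \matrix_(i, j) (vecof e r) (m (f i) (h j)).
have minor_linear f h : linear (minor f h).
  move=> a u v; apply/matrixP => i j; rewrite !mxE (vecof_linear e).
  by rewrite add_lfunE scale_lfunE.
pose L f h : {linear 'rV[K]_(\dim {:dual_space g}) -> 'M[K]_k} :=
  HB.pack (minor f h) (GRing.isLinear.Build _ _ _ _ _ (minor_linear f h)).
move=> /lp_rank_geP[f [h det_neq0]]; split.
  rewrite openE => r /= /lp_rank_geP[f' [h' r_neq0]].
  have : nbhs r [set r | \det (L f' h' r) != 0].
    by apply: open_nbhs_nbhs; split=> //; exact: det_neq0_open.
  by apply: filterS => r' /= r'_neq0; apply/lp_rank_geP; exists f', h'.
have r0_neq0 : \det (L f h (rVof e xi0)) != 0.
  by rewrite /= /minor rVofK ?vbasisP.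
move=> O O0 Oo; have [r [Or r_neq0]] := det_neq0_dense r0_neq0 O0 Oo.
by exists r; split=> //=; apply/lp_rank_geP; exists f, h.
Qed.

(** The coadjoint action carries a sign, which does not change the rank. *)
Lemma orbit_dimE m xi : bilinear_map m ->
  orbit_dim m xi = bivector_rank (lie_poisson m xi).
Proof.
move=> bil; have bil_xi := lie_poisson_bilinear xi bil.
have bilN : bilinear_map (W := K^o) (fun x y => - lie_poisson m xi x y).
  case: bil_xi => bl br; split=> [y a u v|x a u v] /=.
    by rewrite (bl y a u v) opprD scalerN.
  by rewrite (br x a u v) opprD scalerN.
transitivity (bivector_rank (fun x y => - lie_poisson m xi x y)).
  rewrite /orbit_dim /orbit_tangent /bivector_rank.
  congr (\dim (limg (linfun _))); apply/funext => x; apply/lfunP => y.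
  rewrite [RHS]linfun_linearE; last by case: bilN => _; apply.
  rewrite opp_lfunE comp_lfunE linfun_linearE //.
  by case: bil.
by have := rank_scale (c := -1) bil_xi; rewrite oppr_eq0 oner_eq0 => <- //;
  congr bivector_rank; apply/funext => x; apply/funext => y; rewrite mulN1r.
Qed.

Definition max_rank m (D : nat) : Prop :=
  (exists xi, bivector_rank (lie_poisson m xi) = D) /\
  forall xi, (bivector_rank (lie_poisson m xi) <= D)%N.

Lemma max_rank_exists m : exists D, max_rank m D.
Proof.
pose P k := `[< exists xi, bivector_rank (lie_poisson m xi) = k >].
have exP : exists k, P k.
  by exists (bivector_rank (lie_poisson m 0)); apply/asboolP; exists 0.
have ubP k : P k -> (k <= \dim {:dual_space g})%N.
  by move=> /asboolP[xi <-]; apply/dimvS/subvf.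
case: (ex_maxnP exP ubP) => D /asboolP[xi xiD] maxD.
exists D; split=> [|zeta]; first by exists xi.
by apply: maxD; apply/asboolP; exists zeta.
Qed.

Lemma dim_dual : \dim {:dual_space g} = \dim {:g}.
Proof. by rewrite !dimvf; exact: muln1. Qed.

(** Forms of maximal rank form an open dense set, which meets any other open
    dense set on which the orbits have constant codimension; hence the index is
    the codimension of the largest orbits. *)
Lemma lie_indexE m D : bilinear_map m -> max_rank m D ->
  (lie_index m + D)%N = \dim {:g}.
Proof.
move=> bil [[xi0 xi0D] leD].
have leDg : (D <= \dim {:g})%N by rewrite -xi0D -dim_dual; apply/dimvS/subvf.
have index_D : is_index m (\dim {:g} - D)%N.
  exists [set xi | (D <= bivector_rank (lie_poisson m xi))%N]; split.
    by apply: (rank_geq_open_dense (xi0 := xi0)) => //; rewrite xi0D.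
  move=> xi /= geD; rewrite orbit_dimE // dim_dual; congr (_ - _)%N.
  by apply/eqP; rewrite eqn_leq leD.
suff -> : lie_index m = (\dim {:g} - D)%N by rewrite subnK.
have [U [[oU dU] UE]] : is_index m (lie_index m) :=
  xgetPex 0%N (ex_intro _ _ index_D).
have [V [[oV dV] VE]] := index_D.
have [r [_ [Vr Ur]]] := denseI oV dV dU (ex_intro _ 0 I) openT.
by rewrite -(UE _ Ur) -(VE _ Vr).
Qed.

End LiePoissonRank.

(** * The pencil of a Nijenhuis operator *)

Section NijenhuisPencil.
Variables (K : numFieldType) (g : vectType K) (br : g -> g -> g) (N : 'End(g)).
Hypothesis bil : bilinear_map br.
Hypothesis nij : nijenhuis br N.

Lemma nijenhuis_bracket_bilinear : bilinear_map (nijenhuis_bracket br N).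
Proof.
have addrAC3 (x x' y y' z z' : g) :
    x + x' + (y + y') - (z + z') = x + y - z + (x' + y' - z').
  by rewrite (addrACA x) opprD [LHS]addrACA.
case: bil => bl rr; rewrite /nijenhuis_bracket; split=> [y a u v|x a u v].
  rewrite linearP (bl y) (bl (N y)) (bl y) linearP /=.
  by rewrite addrAC3 !scalerDr scalerN.
rewrite linearP (rr (N x)) (rr x) (rr x) linearP /=.
by rewrite addrAC3 !scalerDr scalerN.
Qed.

Definition pencil_bracket (s : K * K) (x y : g) : g :=
  s.1 *: br x y + s.2 *: nijenhuis_bracket br N x y.

Lemma pencil_bracket_bilinear s : bilinear_map (pencil_bracket s).
Proof.
case: bil nijenhuis_bracket_bilinear => [bl rr] [nl nr].
split=> [y a u v|x a u v]; rewrite /pencil_bracket.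
  rewrite (bl y a u v) (nl y a u v) !scalerDr addrACA.
  by rewrite !scalerA ![_ * a]mulrC.
rewrite (rr x a u v) (nr x a u v) !scalerDr addrACA.
by rewrite !scalerA ![_ * a]mulrC.
Qed.

Lemma pencilE s xi :
  pencil (lie_poisson br) (lie_poisson (nijenhuis_bracket br N)) s xi =
  lie_poisson (pencil_bracket s) xi.
Proof.
apply/funext => x; apply/funext => y.
by rewrite /lie_poisson linearD !linearZ.
Qed.

(** At s = (-l, 1) the pencil of brackets is the bracket [,]_M of M = N - l Id,
    which M maps homomorphically to [,]. *)
Lemma nijenhuis_shift l x y (M := (N - l *: \1)%VF) :
  M (pencil_bracket (- l, 1) x y) = br (M x) (M y).
Proof.
case: bil => bl rr.
have brDl u v w : br (u + v) w = br u w + br v w.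
  by have := bl w 1 u v; rewrite /= !scale1r.
have brDr u v w : br w (u + v) = br w u + br w v.
  by have := rr w 1 u v; rewrite /= !scale1r.
have br0l w : br 0 w = 0 by apply: (addrI (br 0 w)); rewrite -brDl !addr0.
have br0r w : br w 0 = 0 by apply: (addrI (br w 0)); rewrite -brDr !addr0.
have brZl c u w : br (c *: u) w = c *: br u w.
  by have := bl w c u 0; rewrite /= addr0 br0l addr0.
have brZr c u w : br w (c *: u) = c *: br w u.
  by have := rr w c u 0; rewrite /= addr0 br0r addr0.
have ME z : M z = N z - l *: z.
  by rewrite add_lfunE opp_lfunE scale_lfunE id_lfunE.
have NN : br (N x) (N y) =
    N (br (N x) y + br x (N y)) - N (N (br x y)).
  by apply/eqP; rewrite -subr_eq0 opprB addrA addrAC nij.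
rewrite /pencil_bracket /nijenhuis_bracket !ME -!scaleNr.
rewrite !(brDl, brDr, brZl, brZr) NN.
have ND u v : N (u + v) = N u + N v by rewrite linearD.
have NB u : N (- u) = - N u by rewrite linearN.
have NZ c u : N (c *: u) = c *: N u by rewrite linearZ.
rewrite !(ND, NB, NZ).
pose c := rVof (vbasis {:g}).
have cD : {morph c : u v / u + v} by move=> u v; rewrite /c linearD.
have cN : {morph c : u / - u} by move=> u; rewrite /c linearN.
have cZ k u : c (k *: u) = k *: c u by rewrite /c linearZ.
apply: (can_inj (rVofK (vbasisP {:g}))).
by rewrite -/c !(cD, cN, cZ); apply/rowP => i; rewrite !mxE /=; ring.
Qed.

Lemma lie_poisson_shift l (eta : dual_space g) x y (M := (N - l *: \1)%VF) :
  lie_poisson (pencil_bracket (- l, 1)) (transpose M eta) x y =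
  lie_poisson br eta (M x) (M y).
Proof. by rewrite /lie_poisson comp_lfunE nijenhuis_shift. Qed.

Lemma rank_shift_regular l eta : ~ leigenvalue N l ->
  bivector_rank (lie_poisson (pencil_bracket (- l, 1))
    (transpose (N - l *: \1%VF) eta)) = bivector_rank (lie_poisson br eta).
Proof.
move=> l_reg; set M := (N - l *: \1)%VF.
have kerM : lker M == 0%VS by apply/negPn/negP.
have MK x : M (M^-1%VF x) = x by rewrite -comp_lfunE lker0_compfV // id_lfunE.
have bil_pencil := lie_poisson_bilinear (transpose M eta)
  (pencil_bracket_bilinear (- l, 1)).
have bil_br := lie_poisson_bilinear eta bil.
apply/eqP; rewrite eqn_leq; apply/andP; split.
  by apply: (rank_le_pullback (p := M) (q := M)) => // x y; exact: lie_poisson_shift.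
apply: (rank_le_pullback (p := M^-1%VF) (q := M^-1%VF)) => // x y.
by rewrite lie_poisson_shift !MK.
Qed.

Lemma transpose_regular_surj l xi : ~ leigenvalue N l ->
  exists eta, transpose (N - l *: \1%VF) eta = xi.
Proof.
move=> l_reg; set M := (N - l *: \1)%VF.
have kerM : lker M == 0%VS by apply/negPn/negP.
exists (xi \o M^-1)%VF; apply/lfunP => x.
by rewrite !comp_lfunE -(comp_lfunE _ M) lker0_compVf // id_lfunE.
Qed.

Lemma sub_bracket_bilinear (h : {vspace g}) :
  bilinear_map (sub_bracket br (h := h)).
Proof.
case: bil => bl rr; rewrite /sub_bracket; split=> [y a u v|x a u v].
  by rewrite linearP bl linearP.
by rewrite linearP rr linearP.
Qed.

(** Every linear form eta on h extends to g by [vsproj h], and the pullback of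
    the extension along M has at least the rank of eta, M being onto h. *)
Lemma rank_shift_singular l D (h := limg (N - l *: \1%VF)) :
  max_rank (sub_bracket br (h := h)) D ->
  exists xi,
    (D <= bivector_rank (lie_poisson (pencil_bracket (- l, 1%R)) xi))%N.
Proof.
set M := (N - l *: \1)%VF => -[[eta etaD] _].
pose etag : dual_space g := linfun (eta \o vsproj h).
have etagE x : etag x = eta (vsproj h x) by rewrite lfunE.
have preim (w : subvs_of h) : {x | M x = vsval w}.
  apply: cid; have /memv_imgP[x _ ->] : vsval w \in limg M by exact: subvsP.
  by exists x.
exists (transpose M etag); rewrite -etaD.
apply: (rank_le_pullback (p := fun w => sval (preim w))
  (q := fun w => sval (preim w))).
- exact/lie_poisson_bilinear/sub_bracket_bilinear.
- exact/lie_poisson_bilinear/pencil_bracket_bilinear.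
- move=> x y; rewrite lie_poisson_shift -/M (svalP (preim x)) (svalP (preim y)).
  by rewrite [RHS]etagE.
Qed.

End NijenhuisPencil.

(** * The Kronecker property *)

Lemma kronecker_nijenhuis (K : numFieldType) (g : vectType K) (br : g -> g -> g)
  (N : 'End(g)) (n : nat) (lambda : 'I_n -> K) :
  bilinear_map br -> nijenhuis br N -> spectrum N = range lambda ->
  (exists U : set (dual_space g), open_dense U /\
     U `<=` ~` (\bigcup_(l in ~` spectrum N)
                  [set transpose (N - l *: \1%VF) xi | xi in sing br])) ->
  (forall i : 'I_n,
     let gi := limg (N - lambda i *: \1%VF) in
     (lie_index (sub_bracket br (h := gi)) + (\dim {:g} - \dim gi))%N
       = lie_index br) ->
  kronecker (pencil (lie_poisson br) (lie_poisson (nijenhuis_bracket br N))).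
Proof.
move=> bil nij specE [U [Uod Usub]] ind_eq.
pose rk s xi := bivector_rank (lie_poisson (pencil_bracket br N s) xi).
have [D maxD] := max_rank_exists br.
have indD := lie_indexE bil maxD.
case: (maxD) => -[xi0 xi0D] leD.
have specP l : leigenvalue N l <-> exists i, l = lambda i.
  have -> : leigenvalue N l <-> spectrum N l by [].
  by rewrite specE; split=> [[i _ <-]|[i ->]]; exists i.
(* xi is the transpose of N - l Id applied to eta, which is not in sing br, and
   a point off sing br has an orbit of maximal dimension. *)
have regular xi l : U xi -> ~ leigenvalue N l -> rk (- l, 1) xi = D.
  move=> Uxi l_reg; have [eta etaE] := transpose_regular_surj xi l_reg.
  rewrite /rk -etaE rank_shift_regular //.
  apply/eqP; rewrite eqn_leq leD /= leqNgt; apply/negP => ltD.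
  apply: (Usub _ Uxi); exists l => //; exists eta => //.
  exists eta; last exact: orbit_refl.
  by exists xi0; rewrite !orbit_dimE // xi0D.
have singular_open_dense i :
    open_dense [set xi | (D <= rk (- lambda i, 1%R) xi)%N].
  have [Di maxDi] := max_rank_exists
    (sub_bracket br (h := limg (N - lambda i *: \1%VF))).
  (* dim gi - Di + dim g - dim gi = dim g - D *)
  have DiD : Di = D.
    have := lie_indexE (sub_bracket_bilinear bil _) maxDi.
    have := ind_eq i; have := dimvS (subvf (limg (N - lambda i *: \1%VF))).
    rewrite [\dim {:subvs_of _}]dimvf /=; move: indD; rewrite /dim /=; lia.
  have [xi xiD] := rank_shift_singular bil nij maxDi.
  rewrite DiD in xiD.
  by apply: rank_geq_open_dense xiD; exact: pencil_bracket_bilinear.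
have singular_le xi i : U xi -> (rk (- lambda i, 1%R) xi <= D)%N.
  move=> Uxi; rewrite leqNgt; apply/negP => gtD.
  have bN := lie_poisson_bilinear xi (nijenhuis_bracket_bilinear N bil).
  have b1 := lie_poisson_bilinear xi bil.
  have rkE t : rk (t, 1) xi = bivector_rank
      (fun x y => lie_poisson (nijenhuis_bracket br N) xi x y +
        t * lie_poisson br xi x y).
    rewrite /rk -pencilE //; congr bivector_rank.
    apply/funext => x; apply/funext => y.
    by rewrite /pencil /= mul1r addrC.
  rewrite rkE in gtD.
  have [p p0 pP] := rank_specialization bN b1 gtD.
  (* The extra factor keeps the parameter k%:R away from the values - lambda j,
     at which the rank is not yet known. *)
  have q0 : p * \prod_j ('X - (- lambda j)%:P) != 0.
    by rewrite mulf_neq0 // monic_neq0 // monic_prod_XsubC.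
  have natK_inj : injective (fun k : nat => k%:R : K).
    by move=> j k /eqP; rewrite eqr_nat => /eqP.
  have [k] := exists_nonroot q0 natK_inj.
  rewrite hornerM horner_prod mulf_eq0 negb_or => /andP[/pP].
  rewrite -rkE -[k%:R]opprK => gtDk /prodf_neq0 k_reg.
  rewrite regular ?ltnn // in gtDk => /specP[j jE].
  by have := k_reg j isT; rewrite hornerXsubC -jE subrr eqxx.
pose W := [set xi | (D <= bivector_rank (lie_poisson br xi))%N].
have Wod : open_dense W.
  by apply: (rank_geq_open_dense (xi0 := xi0)); rewrite ?xi0D.
exists (U `&` (W `&` [set xi | forall i, (D <= rk (- lambda i, 1%R) xi)%N])).
split; first by do 2![apply: open_denseI => //]; exact: open_dense_forall.
move=> xi [Uxi [Wxi sing_ge]].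
suff rkD s : s <> (0, 0) -> bivector_rank (pencil (lie_poisson br)
    (lie_poisson (nijenhuis_bracket br N)) s xi) = D.
  by move=> s t s0 t0; rewrite !rkD.
case: s => s1 s2 s0; have [s20|s20] := eqVneq s2 0.
  have s10 : s1 != 0 by apply: contra_notN s0 => /eqP ->; rewrite s20.
  rewrite s20 (_ : pencil _ _ _ _ = fun x y => s1 * lie_poisson br xi x y).
    rewrite rank_scale //; last exact: lie_poisson_bilinear.
    by apply/eqP; rewrite eqn_leq leD.
  by apply/funext => x; apply/funext => y; rewrite /pencil /= mul0r addr0.
pose l := - (s1 / s2).
have -> : bivector_rank (pencil (lie_poisson br)
    (lie_poisson (nijenhuis_bracket br N)) (s1, s2) xi) = rk (- l, 1) xi.
  have bil_l := lie_poisson_bilinear xi (pencil_bracket_bilinear N bil (- l, 1)).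
  rewrite /rk -(rank_scale bil_l s20).
  congr bivector_rank; apply/funext => x; apply/funext => y.
  by rewrite -pencilE // /pencil /= mulrDr mul1r mulrA /l opprK
    mulrCA divff ?mulr1.
have [/specP[i ->]|l_reg] := pselect (leigenvalue N l); last exact: regular.
by apply/eqP; rewrite eqn_leq singular_le //= sing_ge.
Qed.

Theorem mainTheorem2 (R : realType) (g : vectType R[i]) (br : g -> g -> g)
  (N : 'End(g)) (n : nat) (lambda : 'I_n -> R[i])
  (br_lie : is_lie_bracket br)
  (N_nijenhuis : nijenhuis br N)
  (N_diag : diagonalizable_op N)
  (lambda_inj : injective lambda)
  (lambda_spec : spectrum N = range lambda)
  (sing_small : exists U : set (dual_space g), open_dense U /\
     U `<=` ~` (\bigcup_(l in ~` spectrum N)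
                  [set transpose (N - l *: \1%VF) xi | xi in sing br]))
  (ind_eq : forall i : 'I_n,
     let gi := limg (N - lambda i *: \1%VF) in
     (lie_index (sub_bracket br (h := gi)) + (\dim {:g} - \dim gi))%N
       = lie_index br) :
  kronecker (pencil (lie_poisson br) (lie_poisson (nijenhuis_bracket br N))).
Proof.
have bil : bilinear_map br by case: br_lie.
exact: kronecker_nijenhuis bil N_nijenhuis lambda_spec sing_small ind_eq.
Qed.
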